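(* Let $Q\subset\mathbb{R}^d$ be a convex polytope, $\phi_0:Q\to[0,1]$ a continuous uncertainty density, and $\beta_1,\dots,\beta_N$ sensor detection functions. The heterogeneous sequential deploy and search strategy (defined in the context) can reduce the average uncertainty to any arbitrarily small value in a finite number of iterations; that is, if $(\phi_n)_{n\ge 0}$ is the sequence of uncertainty densities produced by the strategy, then for every $\varepsilon>0$ there is a finite $n$ such that $$\frac{1}{|Q|}\int_Q \phi_n(q)\,dQ<\varepsilon ,$$ where $|Q|$ denotes the $d$-dimensional volume of $Q$.
   Context: Setting. $Q\subset\mathbb{R}^d$ is a convex polytope (bounded, with nonempty interior), the search space. $N$ agents have positions $\mathcal{P}=(p_1,\dots,p_N)\in Q^N$, with $p_i\ne p_j$ for $i\neq j$. The sensor of agent $i$ is described by a detection function $\beta_i:[0,\infty)\to[0,1]$ which is real analytic and strictly increasing; there is no limit on the sensor range. Put $f_i=1-\beta_i$. Generalized Voronoi partition. The cell of agent $i$ is $$V_i=\{q\in Q : f_i(\|p_i-q\|)\ge f_j(\|p_j-q\|)\ \ \forall j\ne i\}.$$ Uncertainty update. When search number $n$ (counting from $n=0$) is performed with the agents at $\mathcal{P}$, the uncertainty density is updated by $$\phi_{n+1}(q)=\phi_n(q)\,\min_{1\le i\le N}\beta_i(\|p_i-q\|),\qquad q\in Q .$$ Centroids. For the current density $\phi_n$, set $\tilde\phi_n(q)=-\phi_n(q)\,\frac{\partial f_i(r_i)}{\partial (r_i^2)}$ for $q\in V_i$, $r_i=\|q-p_i\|$; $\tilde M_{V_i}=\int_{V_i}\tilde\phi_n\,dQ$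 and $\tilde C_{V_i}=\tilde M_{V_i}^{-1}\int_{V_i}q\,\tilde\phi_n(q)\,dQ$ are the mass and centroid of $V_i$ with density $\tilde\phi_n$. Heterogeneous sequential deploy and search. Each iteration $n=0,1,2,\dots$ consists of (i) a deployment step: with $\phi_n$ held fixed, the agents move in $Q$ under the control law $\dot p_i=-k_{prop}(p_i-\tilde C_{V_i})$, $k_{prop}>0$, starting from their positions at the end of the previous iteration (arbitrary initial positions in $Q$ for $n=0$), until each agent is at (or within a prescribed tolerance of) the centroid $\tilde C_{V_i}$ of its cell; (ii) a search step: with the agents at the resulting configuration in $Q^N$, the density is updated from $\phi_n$ to $\phi_{n+1}$ by the update rule above. The number of iterations is the number of ``deploy and search'' steps. *)

(* Defs.v *)
From HB Require Import structures.
From mathcomp Require Import all_boot all_order all_algebra.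
From mathcomp Require Import all_classical all_reals all_analysis.

Set Implicit Arguments.
Unset Strict Implicit.
Unset Printing Implicit Defensive.

Import Order.TTheory GRing.Theory Num.Theory.
Import numFieldNormedType.Exports.

Local Open Scope classical_set_scope.
Local Open Scope ring_scope.

(* Points of R^n are row vectors 'rV[R]_n, whose
   topology (generated by the sup norm) is the usual one.  The sigma-algebra on
   'rV[R]_n is generated by the coordinates, i.e. it is the Borel one. *)
Section measurable_rV.
Context {d} {T : measurableType d}.
Variable n : nat.

Let coord (i : 'I_n) (x : 'rV[T]_n) : T := x ord0 i.

Let rV_set0 : g_sigma_preimage coord set0.
Proof. exact: sigma_algebra0. Qed.

Let rV_setC A : g_sigma_preimage coord A -> g_sigma_preimage coord (~` A).
Proof. exact: sigma_algebraC. Qed.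

Let rV_bigcup (F : _^nat) : (forall i, g_sigma_preimage coord (F i)) ->
  g_sigma_preimage coord (\bigcup_i (F i)).
Proof. exact: sigma_algebra_bigcup. Qed.

HB.instance Definition _ := @isMeasurable.Build (measure_tuple_display d)
  'rV[T]_n (g_sigma_preimage coord) rV_set0 rV_setC rV_bigcup.

End measurable_rV.


Lemma measurable_coord d (T : measurableType d) n (i : 'I_n) :
  measurable_fun [set: 'rV[T]_n] (fun x : 'rV[T]_n => x ord0 i).
Proof.
move=> _ Y mY; rewrite setTI; apply: sub_sigma_algebra => /=.
rewrite -bigcup_seq/=; exists i => /=; first by rewrite mem_index_enum.
by exists Y => //; rewrite setTI.
Qed.

Lemma measurable_fun_coordP d1 d2 (T1 : measurableType d1)
    (T2 : measurableType d2) n (f : T1 -> 'rV[T2]_n) :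
  (forall i, measurable_fun [set: T1] (fun x => f x ord0 i)) ->
  measurable_fun [set: T1] f.
Proof.
move=> mf _ A mA; rewrite setTI.
suff : g_sigma_preimage (fun i => (fun x : 'rV[T2]_n => x ord0 i) \o f)
    `<=` measurable.
  by rewrite g_sigma_preimage_comp; apply; exists A => //; rewrite setTI.
apply: smallest_sub; first exact: sigma_algebra_measurable.
case: n => [|n] in f mf A mA *; first by rewrite big_ord0.
rewrite -bigcup_mkord_ord; apply: bigcup_sub => i Ii.
by move=> B [C mC <-]; exact: mf.
Qed.

Section lebesgue_rV.
Context {R : realType}.
Local Open Scope ereal_scope.

Definition rV_cons n (z : measurableTypeR R * 'rV[R]_n) :
    'rV[R]_n.+1 :=
  \row_i oapp (fun j => z.2 ord0 j) z.1 (unlift ord0 i).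

Definition rV_uncons n (x : 'rV[R]_n.+1) :
    measurableTypeR R * 'rV[R]_n :=
  (x ord0 ord0, \row_j x ord0 (lift ord0 j)).

Lemma rV_consK n : cancel (@rV_cons n) (@rV_uncons n).
Proof.
move=> [a x]; congr pair; first by rewrite mxE unlift_none.
by apply/rowP => j; rewrite !mxE liftK.
Qed.

Lemma measurable_rV_cons n : measurable_fun setT (@rV_cons n).
Proof.
apply: measurable_fun_coordP => i.
under eq_fun do rewrite mxE.
case: (unlift ord0 i) => [j|] /=; last exact: measurable_fst.
exact: (measurableT_comp (@measurable_coord _ R n j) measurable_snd).
Qed.

Lemma measurable_rV_uncons n : measurable_fun setT (@rV_uncons n).
Proof.
apply: measurable_fun_pair; first exact: measurable_coord.
apply: measurable_fun_coordP => i.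
by under eq_fun do rewrite mxE; exact: measurable_coord.
Qed.

Section cons_measure.
Variables (n : nat)
  (mu : {sigma_finite_measure set 'rV[R]_n -> \bar R}).

Definition cons_measure (A : set 'rV[R]_n.+1) : \bar R :=
  pushforward (lebesgue_measure \x mu) (@rV_cons n) A.

Let push : {measure set 'rV[R]_n.+1 -> \bar R} :=
  measure_function_pushforward__canonical__measure_function_Measure
    (lebesgue_measure \x mu) (@measurable_rV_cons n).

Let cm0 : cons_measure set0 = 0.
Proof. exact: (measure0 push). Qed.

Let cm_ge0 A : 0 <= cons_measure A.
Proof. exact: (measure_ge0 push). Qed.

Let cm_sigma_additive : semi_sigma_additive cons_measure.
Proof.
exact: (@measure_semi_sigma_additive _ _ _ push).
Qed.

HB.instance Definition _ := isMeasure.Build _ _ _ cons_measure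
  cm0 cm_ge0 cm_sigma_additive.

Let cm_sigma_finite : sigma_finite setT cons_measure.
Proof.
have /sigma_finiteP[F [TF ndF Foo]] := sigma_finiteT (@lebesgue_measure R).
have /sigma_finiteP[G [TG ndG Goo]] := sigma_finiteT mu.
exists (fun k => @rV_uncons n @^-1` (F k `*` G k)).
  apply/seteqP; split=> // x _.
  have [i _ Fi] : (\bigcup_i F i) (rV_uncons x).1 by rewrite -TF.
  have [j _ Gj] : (\bigcup_i G i) (rV_uncons x).2 by rewrite -TG.
  exists (maxn i j) => //; split.
  - by move: Fi; exact/subsetPset/ndF/leq_maxl.
  - by move: Gj; exact/subsetPset/ndG/leq_maxr.
move=> k; have [mF Fk] := Foo k; have [mG Gk] := Goo k; split.
  rewrite -[X in measurable X]setTI; apply: measurable_rV_uncons => //.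
  exact: measurableX.
rewrite /cons_measure /pushforward -comp_preimage.
rewrite (_ : _ \o _ = id); last by apply/funext => z; exact: rV_consK.
rewrite preimage_id product_measure1E//.
by rewrite lte_mul_pinfty// ge0_fin_numE.
Qed.

HB.instance Definition _ := Measure_isSigmaFinite.Build _ _ _ cons_measure
  cm_sigma_finite.

End cons_measure.

(* n-dimensional Lebesgue measure, as the n-fold product of the Lebesgue
   measure on R; lebesgue_rV_box is a sanity check. *)
Fixpoint lebesgue_rV n :
    {sigma_finite_measure set 'rV[R]_n -> \bar R} :=
  if n is n'.+1 then cons_measure (lebesgue_rV n') else dirac (0%R : 'rV[R]_0).

Lemma lebesgue_rV_box n (a b : 'rV[R]_n) :
  (forall i, a ord0 i <= b ord0 i)%R ->
  lebesgue_rV n [set x : 'rV[R]_n | forall i, x ord0 i \in `[a ord0 i, b ord0 i]] =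
  (\prod_(i < n) (b ord0 i - a ord0 i))%:E.
Proof.
elim: n a b => [|n IHn] a b ab /=.
  by rewrite big_ord0 diracE mem_set//= => -[].
pose a' := \row_j a ord0 (lift ord0 j); pose b' := \row_j b ord0 (lift ord0 j).
rewrite /cons_measure /pushforward.
rewrite [X in _ X = _](_ : _ = `[a ord0 ord0, b ord0 ord0] `*`
  [set x : 'rV[R]_n | forall i, x ord0 i \in `[a' ord0 i, b' ord0 i]]).
  rewrite product_measure1E//.
  - rewrite IHn; last by move=> i; rewrite !mxE.
    rewrite -[X in X * _]/(lebesgue_measure _) lebesgue_measure_itv/= lte_fin big_ord_recl EFinM.
    congr (_ * _%:E); last by apply: eq_bigr => i _; rewrite !mxE.
    have [//|] := ltP (a ord0 ord0) (b ord0 ord0).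
    by move=> ba; rewrite (le_anti (introT andP (conj (ab ord0) ba))) subrr.
  - rewrite [X in measurable X](_ : _ = \big[setI/setT]_(i < n)
      [set x : 'rV[R]_n | x ord0 i \in `[a' ord0 i, b' ord0 i]]); last first.
      apply/seteqP; split=> x.
        by move=> abx; elim/big_ind : _ => // i _; exact: abx.
      by move=> + i; rewrite (bigD1 i)//= => -[].
    elim/big_ind : _ => [|A B mA mB|i _]; first exact: measurableT.
      exact: measurableI.
    rewrite -[X in measurable X]setTI.
    exact: (@measurable_coord _ R n i measurableT _ (measurable_itv _)).
apply/seteqP; split => -[x y] /=.
- move=> xy; split; first by have := xy ord0; rewrite mxE unlift_none.
  by move=> i; have := xy (lift ord0 i); rewrite !mxE liftK.
- move=> [x0 yi] i; rewrite mxE; case: unliftP => [j ->|->] //=.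
  by have := yi j; rewrite !mxE.
Qed.

End lebesgue_rV.

Section deploy_and_search.
Context {R : realType}.
Variables (d N : nat).
Implicit Types (Q : set 'rV[R]_d) (P : 'I_N -> 'rV[R]_d) (beta : 'I_N -> R -> R)
  (phi : 'rV[R]_d -> R).

(* The norm `|x| of 'rV[R]_d is the sup norm, hence this definition. *)
Definition enorm (x : 'rV[R]_d) : R := Num.sqrt (\sum_i x ord0 i ^+ 2).

Definition volume (A : set 'rV[R]_d) : R := fine (lebesgue_rV d A).

Definition convex_polytope Q : Prop :=
  [/\ exists m (a : 'I_m -> 'rV[R]_d) (b : 'I_m -> R),
         Q = [set q | forall i, \sum_k a i ord0 k * q ord0 k <= b i],
      bounded_set Q
    & interior Q !=set0].

(* Real analyticity on the closed half-line [0, +oo[: at 0 the power series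
   is only required to represent the function on the right. *)
Definition analytic_on_halfline (b : R -> R) : Prop :=
  forall r0, 0 <= r0 -> exists (rho : R) (a : R^nat), 0 < rho /\
    forall r, 0 <= r -> `|r - r0| < rho ->
      series (fun k => a k * (r - r0) ^+ k) @ \oo --> b r.

(* Only the values at nonnegative arguments (distances) are meaningful. *)
Definition detection_function (b : R -> R) : Prop :=
  [/\ forall r, 0 <= r -> 0 <= b r <= 1,
      analytic_on_halfline b
    & forall r s, 0 <= r -> r < s -> b r < b s].

Definition configuration Q P : Prop := (forall i, Q (P i)) /\ injective P.

Definition miss beta (i : 'I_N) (r : R) : R := 1 - beta i r.

Definition voronoi_cell Q beta P (i : 'I_N) : set 'rV[R]_d :=
  [set q | Q q /\ forall j, j != i ->
     miss beta j (enorm (P j - q)) <= miss beta i (enorm (P i - q))].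

(* The derivative with respect to r^2 is that of s |-> f_i (sqrt s), taken at
   s = r^2.  For q = P i (s = 0) the value is immaterial: a single point. *)
Definition perceived_density beta P phi (i : 'I_N) (q : 'rV[R]_d) : R :=
  - phi q * derive1 (fun s : R => miss beta i (Num.sqrt s)) (enorm (q - P i) ^+ 2).

Definition cell_mass Q beta P phi (i : 'I_N) : \bar R :=
  (\int[lebesgue_rV d]_(q in voronoi_cell Q beta P i)
     (perceived_density beta P phi i q)%:E)%E.

Definition cell_centroid Q beta P phi (i : 'I_N) : 'rV[R]_d :=
  (fine (cell_mass Q beta P phi i))^-1 *:
  \row_k \int[lebesgue_rV d]_(q in voronoi_cell Q beta P i)
     (q ord0 k * perceived_density beta P phi i q).

(* A generalized Voronoi cell may be empty or of mass zero, and for d = 1 the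
   mass may be infinite; the centroid then has no meaning. *)
Definition has_centroid Q beta P phi (i : 'I_N) : Prop :=
  (0 < cell_mass Q beta P phi i < +oo)%E.

(* Motion p under the control law during the time interval from 0 to T, where
   T may be +oo.  An agent whose cell has no centroid is not constrained by the
   control law, so every convention for such agents is covered. *)
Definition controlled_motion Q beta (kprop : R) phi (T : \bar R)
    (p : R -> 'I_N -> 'rV[R]_d) : Prop :=
  let J := [set t : R | 0 <= t /\ (t%:E <= T)%E] in
  [/\ forall t, J t -> configuration Q (p t),
      forall i, {within J, continuous (fun t => p t i)}
    & forall t i, 0 < t -> (t%:E < T)%E -> has_centroid Q beta (p t) phi i ->
        is_derive t 1 (fun s => p s i)
          (- kprop *: (p t i - cell_centroid Q beta (p t) phi i))].

Definition at_centroids Q beta (tol : R) phi P : Prop :=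
  forall i, has_centroid Q beta P phi i ->
    enorm (P i - cell_centroid Q beta P phi i) <= tol.

(* Since the approach to the centroids is in general only asymptotic, the final
   configuration is either reached at a finite time T or is the limit of the
   motion as time tends to +oo. *)
Inductive deployment Q beta (kprop tol : R) phi (P P' : 'I_N -> 'rV[R]_d) :
    Prop :=
| Deployment_finite (T : R) (p : R -> 'I_N -> 'rV[R]_d) of
    0 <= T & controlled_motion Q beta kprop phi T%:E p &
    p 0 = P & p T = P' & at_centroids Q beta tol phi P'
| Deployment_limit (p : R -> 'I_N -> 'rV[R]_d) of
    controlled_motion Q beta kprop phi +oo%E p &
    p 0 = P & (forall i, p t i @[t --> +oo] --> P' i) &
    configuration Q P' & at_centroids Q beta tol phi P'.

(* The neutral element 1 of the minimum is harmless, the values of detection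
   functions being at most 1. *)
Definition search beta P phi (q : 'rV[R]_d) : R :=
  phi q * \big[Num.min/1]_(i < N) beta i (enorm (P i - q)).

(* P n is the configuration at the beginning of iteration n and P n.+1 the one
   at its end, at which the search number n is performed. *)
Definition deploy_and_search Q beta (kprop tol : R) (phi0 : 'rV[R]_d -> R)
    (P : nat -> 'I_N -> 'rV[R]_d) (phi : nat -> 'rV[R]_d -> R) : Prop :=
  [/\ configuration Q (P 0%N),
      forall q, Q q -> phi 0%N q = phi0 q,
      forall n, deployment Q beta kprop tol (phi n) (P n) (P n.+1)
    & forall n q, Q q -> phi n.+1 q = search beta (P n.+1) (phi n) q].

Definition average_uncertainty Q phi : R :=
  (volume Q)^-1 * \int[lebesgue_rV d]_(q in Q) phi q.

End deploy_and_search.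

(* Main.v *)
Require Import Defs.
From HB Require Import structures.
From mathcomp Require Import all_boot all_order all_algebra.
From mathcomp Require Import all_classical all_reals all_analysis.

Set Implicit Arguments.
Unset Strict Implicit.
Unset Printing Implicit Defensive.

Import Order.TTheory GRing.Theory Num.Theory.
Import numFieldNormedType.Exports.

Local Open Scope classical_set_scope.
Local Open Scope ring_scope.

(** Wherever the deployment leads the agents, they stay in Q.  As Q is bounded,
    the distances between its points are at most some D, so in each search agent
    0 alone leaves, at every point of Q, at most the fraction c = beta_0(D) of
    the uncertainty, and the other agents can only lower the minimum that is
    taken ([search_bounds]).  A strictly increasing function with values in
    [0, 1] stays below 1, hence c < 1 ([detection_function_lt1]).  By induction
    phi_n is at most c ^ n on Q ([uncertainty_bounds]), so its average over Q is
    at most c ^ n ([average_uncertainty_le]), and c ^ n tends to 0. *)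

(** The integral of a nonnegative function is the supremum of the integrals of
    the nonnegative simple functions below it, which makes it monotone without
    any measurability assumption.  The uncertainty densities are thereby
    integrated without a study of their regularity. *)
Lemma ge0_integral_mono d (T : measurableType d) (R : realType)
    (mu : {measure set T -> \bar R}) (D : set T) (f g : T -> \bar R) :
  (forall x, D x -> (0 <= f x)%E) -> (forall x, D x -> (f x <= g x)%E) ->
  (\int[mu]_(x in D) f x <= \int[mu]_(x in D) g x)%E.
Proof.
move=> f0 fg.
have g0 x : D x -> (0 <= g x)%E by move=> Dx; exact: le_trans (f0 _ Dx) (fg _ Dx).
rewrite !ge0_integralE//; apply: ereal_sup_le.
move=> _ [h hf <-]; exists h => // x; apply: le_trans (hf x) _.
by rewrite !patchE; case: ifPn => // /set_mem; exact: fg.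
Qed.

Lemma measurable_halfspaces (R : realType) d m (a : 'I_m -> 'rV[R]_d)
    (b : 'I_m -> R) :
  measurable [set q : 'rV[R]_d | forall i, \sum_k a i ord0 k * q ord0 k <= b i].
Proof.
rewrite [X in measurable X](_ : _ = \bigcap_(i in [set: 'I_m])
    ((fun q : 'rV[R]_d => \sum_k a i ord0 k * q ord0 k) @^-1` `]-oo, b i])).
  apply: fin_bigcap_measurable; first exact: finite_finset.
  move=> i _; rewrite -[X in measurable X]setTI.
  suff: measurable_fun [set: 'rV[R]_d]
      (fun q : 'rV[R]_d => \sum_k a i ord0 k * q ord0 k) by apply.
  apply: measurable_sum => k.
  apply: measurable_realfun.measurable_funM; first exact: measurable_cst.
  exact: (@measurable_coord _ R d k).
by apply/seteqP; split => q /= qab i => [_|];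
  have := qab i; rewrite /= in_itv/=; apply.
Qed.

Lemma bounded_set_enorm (R : realType) d (Q : set 'rV[R]_d) : bounded_set Q ->
  exists2 D : R, 0 <= D & forall p q, Q p -> Q q -> enorm (p - q) <= D.
Proof.
move=> [M [_ QM]].
have {}QM q k : Q q -> `|q ord0 k| <= M + 1.
  move=> Qq; apply: le_trans (QM (M + 1) _ _ Qq); last by rewrite ltrDl.
  rewrite [leRHS]/Num.Def.normr /= mx_normrE.
  by apply/bigmax_geP; right => /=; exists (ord0, k).
exists (Num.sqrt (\sum_(k < d) ((M + 1) + (M + 1)) ^+ 2)); first exact: sqrtr_ge0.
move=> p q Qp Qq; apply: ler_wsqrtr; apply: ler_sum => k _.
rewrite -real_normK ?num_real// !mxE lerXn2r ?nnegrE//.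
  by apply: addr_ge0; apply: le_trans (QM _ k Qp).
by apply: le_trans (ler_normB _ _) _; rewrite lerD// QM.
Qed.

Lemma detection_function_lt1 (R : realType) (b : R -> R) (r : R) :
  detection_function b -> 0 <= r -> b r < 1.
Proof.
move=> [b01 _ bmono] r0; apply: (@lt_le_trans _ _ (b (r + 1))).
  by apply: bmono => //; rewrite ltrDl.
by have /andP[] := b01 (r + 1) (addr_ge0 r0 ler01).
Qed.

Lemma detection_function_le (R : realType) (b : R -> R) (r s : R) :
  detection_function b -> 0 <= r -> r <= s -> b r <= b s.
Proof.
move=> [_ _ bmono] r0; rewrite le_eqVlt => /predU1P[->//|rs].
exact/ltW/bmono.
Qed.

Section strategy.
Variables (R : realType) (d N : nat).
Implicit Types (Q : set 'rV[R]_d) (P : 'I_N -> 'rV[R]_d) (beta : 'I_N -> R -> R)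
  (phi : 'rV[R]_d -> R).

Lemma enorm_ge0 (x : 'rV[R]_d) : 0 <= enorm x.
Proof. exact: sqrtr_ge0. Qed.

Lemma deployment_configuration Q beta kprop tol phi P P' :
  deployment Q beta kprop tol phi P P' -> configuration Q P'.
Proof. by case=> // T p T0 [+ _ _] _ <- _; apply; split => /=. Qed.

(** One agent at distance at most D from q gives the bound on the minimum of all
    the detection functions; keeping the lower bound 0 next to it lets the lemma
    be iterated. *)
Lemma search_bounds beta P phi (i : 'I_N) (q : 'rV[R]_d) (D a : R) :
  (forall j, detection_function (beta j)) -> enorm (P i - q) <= D ->
  0 <= phi q <= a -> 0 <= search beta P phi q <= a * beta i D.
Proof.
move=> hbeta PD /andP[phi0 phia].
have min0 : 0 <= \big[Num.min/1]_(j < N) beta j (enorm (P j - q)).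
  apply: le_bigmin => // j _; have [b01 _ _] := hbeta j.
  by have /andP[] := b01 _ (enorm_ge0 (P j - q)).
rewrite /search mulr_ge0//=; apply: ler_pM => //.
apply: le_trans (bigmin_le _ i _) _.
exact: detection_function_le (hbeta i) (enorm_ge0 _) PD.
Qed.

Lemma uncertainty_bounds Q beta kprop tol phi0 (P : nat -> 'I_N -> 'rV[R]_d)
    (phi : nat -> 'rV[R]_d -> R) (i : 'I_N) (D : R) :
  (forall j, detection_function (beta j)) ->
  (forall p q, Q p -> Q q -> enorm (p - q) <= D) ->
  (forall q, Q q -> 0 <= phi0 q <= 1) ->
  deploy_and_search Q beta kprop tol phi0 P phi ->
  forall n q, Q q -> 0 <= phi n q <= beta i D ^+ n.
Proof.
move=> hbeta QD phi01 [_ phi0E dep searchE]; elim=> [|n IHn] q Qq.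
  by rewrite phi0E// expr0 phi01.
rewrite searchE// exprSr; apply: search_bounds => //; last exact: IHn.
by apply: QD => //; have [] := deployment_configuration (dep n).
Qed.

Lemma average_uncertainty_le Q phi (a : R) : measurable Q -> 0 <= a ->
  (forall q, Q q -> 0 <= phi q <= a) -> average_uncertainty Q phi <= a.
Proof.
move=> mQ a0 phia; rewrite /average_uncertainty.
(* An infinite volume is sent to 0 by [fine], as a null one is; in both cases
   the average is 0, the inverse of 0 being 0. *)
have [->|V0] := eqVneq (volume Q) 0; first by rewrite invr0 mul0r.
have Vge0 : 0 <= volume Q by exact/fine_ge0/measure_ge0.
have Qfin : lebesgue_rV d Q \is a fin_num.
  by move: V0; rewrite /volume; case: (lebesgue_rV d Q) => [r||]//=; rewrite eqxx.
rewrite mulrC ler_pdivrMr ?lt_def ?V0//.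
have le_int : (\int[lebesgue_rV d]_(q in Q) (phi q)%:E <=
    (a * volume Q)%:E)%E.
  rewrite EFinM fineK// -(integral_cst _ mQ).
  by apply: ge0_integral_mono => q Qq; rewrite lee_fin; have /andP[] := phia q Qq.
rewrite /Rintegral -[leRHS]/(fine (a * volume Q)%:E).
rewrite fine_le// ge0_fin_numE.
  exact: le_lt_trans le_int (ltry _).
by apply: integral_ge0 => q Qq; rewrite lee_fin; have /andP[] := phia q Qq.
Qed.

End strategy.

Theorem theorem7 (R : realType) (d N : nat) (hd : (0 < d)%N) (hN : (0 < N)%N)
    (Q : set 'rV[R]_d) (hQ : convex_polytope Q)
    (beta : 'I_N -> R -> R) (hbeta : forall i, detection_function (beta i))
    (phi0 : 'rV[R]_d -> R) (phi0_cont : {within Q, continuous phi0})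
    (phi0_range : forall q, Q q -> 0 <= phi0 q <= 1)
    (kprop : R) (hkprop : 0 < kprop) (tol : R) (htol : 0 <= tol)
    (P : nat -> 'I_N -> 'rV[R]_d) (phi : nat -> 'rV[R]_d -> R)
    (strategy : deploy_and_search Q beta kprop tol phi0 P phi) :
  forall eps : R, 0 < eps ->
    exists n : nat, average_uncertainty Q (phi n) < eps.
Proof.
move=> eps eps0; have [[m [a [b QE]]] /bounded_set_enorm[D D0 QD] _] := hQ.
have mQ : measurable Q by rewrite QE; exact: measurable_halfspaces.
pose c := beta (Ordinal hN) D.
have c0 : 0 <= c by have [b01 _ _] := hbeta (Ordinal hN); have /andP[] := b01 D D0.
have c1 : `|c| < 1 by rewrite ger0_norm// detection_function_lt1.
have [n _ /(_ n (leqnn n)) cn] := cvgr_lt _ (cvg_expr c1) _ eps0.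
exists n; apply: le_lt_trans cn.
apply: average_uncertainty_le => //; first exact: exprn_ge0.
exact: uncertainty_bounds strategy n.
Qed.
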